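(* Let $n\ge 2$ and let $X_n$ be either $WSG_n$ or $UVSG_n$. The canonical homomorphism $\phi^{X_n}_{1,1,1}\colon X_n\to S_n$, which sends each of $\sigma_i,\tau_i,v_i$ to $(i\ i+1)$ for $1\le i\le n-1$, is surjective and induces a semi-direct product decomposition $X_n=\operatorname{Ker}(\phi^{X_n}_{1,1,1})\rtimes S_n$.
   Context: For $n\ge 2$, $VSG_n$ is the group with generators $\sigma_1,\dots,\sigma_{n-1},\tau_1,\dots,\tau_{n-1},v_1,\dots,v_{n-1}$ and relations (for all admissible indices): $\sigma_i\sigma_j=\sigma_j\sigma_i$, $v_iv_j=v_jv_i$, $\tau_i\tau_j=\tau_j\tau_i$, $\sigma_i\tau_j=\tau_j\sigma_i$, $\sigma_iv_j=v_j\sigma_i$, $\tau_iv_j=v_j\tau_i$ whenever $|i-j|\ge 2$; $v_i^2=1$ and $\sigma_i\tau_i=\tau_i\sigma_i$ for $1\le i\le n-1$; and for $1\le i\le n-2$: $\sigma_i\sigma_{i+1}\sigma_i=\sigma_{i+1}\sigma_i\sigma_{i+1}$, $v_iv_{i+1}v_i=v_{i+1}v_iv_{i+1}$, $\sigma_i\sigma_{i+1}\tau_i=\tau_{i+1}\sigma_i\sigma_{i+1}$, $\sigma_{i+1}\sigma_i\tau_{i+1}=\tau_i\sigma_{i+1}\sigma_i$, $v_i\sigma_{i+1}v_i=v_{i+1}\sigma_iv_{i+1}$, $v_i\tau_{i+1}v_i=v_{i+1}\tau_iv_{i+1}$. The welded singular braid group $WSG_n$ is the quotient of $VSG_n$ by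 the relations $\sigma_i\sigma_{i+1}v_i=v_{i+1}\sigma_i\sigma_{i+1}$, $1\le i\le n-2$. The unrestricted virtual singular braid group $UVSG_n$ is the quotient of $VSG_n$ by the relations $\sigma_i\sigma_{i+1}v_i=v_{i+1}\sigma_i\sigma_{i+1}$ and $v_i\sigma_{i+1}\sigma_i=\sigma_{i+1}\sigma_iv_{i+1}$, $1\le i\le n-2$. The same symbols denote generators of $VSG_n$ and their images in the quotients. The semi-direct product decomposition means that the short exact sequence $1\to\operatorname{Ker}(\phi^{X_n}_{1,1,1})\to X_n\to S_n\to1$ splits. *)

(* Defs.v *)
From HB Require Import structures.
From mathcomp Require Import all_boot all_fingroup.
From mathcomp Require Import boolp.

Set Implicit Arguments.
Unset Strict Implicit.
Unset Printing Implicit Defensive.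

Local Open Scope quotient_scope.
Local Open Scope group_scope.

Local Notation repr := generic_quotient.repr.

Notation group_hom := UMagmaMorphism.type.

Section FreeGroup.
Variable X : choiceType.

(* A letter is (x, false) for the generator x and (x, true) for its inverse. *)
Definition word := seq (X * bool).

Inductive free_eq : word -> word -> Prop :=
| free_eq_refl w : free_eq w w
| free_eq_sym w1 w2 : free_eq w1 w2 -> free_eq w2 w1
| free_eq_trans w1 w2 w3 : free_eq w1 w2 -> free_eq w2 w3 -> free_eq w1 w3
| free_eq_cancel w1 w2 x b :
    free_eq (w1 ++ [:: (x, b), (x, ~~ b) & w2]) (w1 ++ w2).

Definition free_eqb : rel word := fun u v => `[< free_eq u v >].

Lemma free_eqb_refl : reflexive free_eqb.
Proof. by move=> u; apply/asboolP/free_eq_refl. Qed.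

Lemma free_eqb_sym : symmetric free_eqb.
Proof. by move=> u v; apply/asboolP/asboolP; apply: free_eq_sym. Qed.

Lemma free_eqb_trans : transitive free_eqb.
Proof.
move=> v u w /asboolP uv /asboolP vw; apply/asboolP.
exact: free_eq_trans uv vw.
Qed.

Canonical free_equiv :=
  EquivRel free_eqb free_eqb_refl free_eqb_sym free_eqb_trans.

Definition free_group := {eq_quot free_equiv}.
HB.instance Definition _ := Choice.on free_group.

Lemma free_piP (u v : word) :
  (\pi_free_group u = \pi_free_group v) <-> free_eq u v.
Proof. by split=> [/eqmodP/asboolP|uv]; [|apply/eqmodP/asboolP]. Qed.

Lemma free_eq_cat u1 u2 v1 v2 :
  free_eq u1 u2 -> free_eq v1 v2 -> free_eq (u1 ++ v1) (u2 ++ v2).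
Proof.
move=> Hu Hv; apply: (@free_eq_trans _ (u2 ++ v1)).
  elim: Hu => {u1 u2 Hv v2} [w|w1 w2 _|w1 w2 w3 _ H1 _|w1 w2 x b].
  - exact: free_eq_refl.
  - exact: free_eq_sym.
  - exact: free_eq_trans.
  - by rewrite -!catA /=; apply: free_eq_cancel.
elim: Hv => {u1 Hu v1 v2} [w|w1 w2 _|w1 w2 w3 _ H1 _|w1 w2 x b].
- exact: free_eq_refl.
- exact: free_eq_sym.
- exact: free_eq_trans.
- by rewrite !catA; apply: free_eq_cancel.
Qed.

Definition word_inv (w : word) : word := rev [seq (a.1, ~~ a.2) | a <- w].

Lemma word_invK : involutive word_inv.
Proof.
move=> w; rewrite /word_inv map_rev revK -map_comp -[RHS]map_id.
by apply: eq_map => -[x b] /=; rewrite negbK.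
Qed.

Lemma free_eq_inv u v : free_eq u v -> free_eq (word_inv u) (word_inv v).
Proof.
elim=> {u v} [w|w1 w2 _|w1 w2 w3 _ H1 _|w1 w2 x b].
- exact: free_eq_refl.
- exact: free_eq_sym.
- exact: free_eq_trans.
- rewrite /word_inv !map_cat !rev_cat /= !rev_cons -!cats1 -!catA /= negbK.
  exact: free_eq_cancel.
Qed.

Lemma free_eq_invl w : free_eq (word_inv w ++ w) [::].
Proof.
elim: w => [|[x b] w IH]; first exact: free_eq_refl.
rewrite /word_inv /= rev_cons -cats1 -catA /= -/(word_inv w).
apply: free_eq_trans IH.
by have := free_eq_cancel (word_inv w) w x (~~ b); rewrite negbK.
Qed.

Definition free_one : free_group := \pi_free_group [::].
Definition free_mul (a b : free_group) : free_group :=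
  \pi_free_group (repr a ++ repr b).
Definition free_inv (a : free_group) : free_group :=
  \pi_free_group (word_inv (repr a)).

Lemma free_repr u : free_eq (repr (\pi_free_group u)) u.
Proof. by apply/free_piP; rewrite reprK. Qed.

Lemma free_mul_pi u v :
  free_mul (\pi_free_group u) (\pi_free_group v) = \pi_free_group (u ++ v).
Proof. by apply/free_piP; apply: free_eq_cat; apply: free_repr. Qed.

Lemma free_inv_pi u : free_inv (\pi_free_group u) = \pi_free_group (word_inv u).
Proof. by apply/free_piP; apply/free_eq_inv/free_repr. Qed.

Lemma free_piW (P : free_group -> Prop) :
  (forall u, P (\pi_free_group u)) -> forall a, P a.
Proof. by move=> HP a; rewrite -[a]reprK. Qed.

Lemma free_mulA : associative free_mul.
Proof.
move=> a b c; elim/free_piW: a => u; elim/free_piW: b => v.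
by elim/free_piW: c => w; rewrite !free_mul_pi catA.
Qed.

Lemma free_mul1 : left_id free_one free_mul.
Proof. by move=> a; elim/free_piW: a => u; rewrite free_mul_pi. Qed.

Lemma free_mulr1 : right_id free_one free_mul.
Proof. by move=> a; elim/free_piW: a => u; rewrite free_mul_pi cats0. Qed.

Lemma free_mulV : left_inverse free_one free_inv free_mul.
Proof.
move=> a; elim/free_piW: a => u; rewrite free_inv_pi free_mul_pi.
by apply/free_piP/free_eq_invl.
Qed.

Lemma free_mulrV : right_inverse free_one free_inv free_mul.
Proof.
move=> a; elim/free_piW: a => u; rewrite free_inv_pi free_mul_pi.
by apply/free_piP; rewrite -{1}[u]word_invK; apply: free_eq_invl.
Qed.

HB.instance Definition _ := isGroup.Build free_group
  free_mulA free_mul1 free_mulr1 free_mulV free_mulrV.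

Definition free_gen (x : X) : free_group := \pi_free_group [:: (x, false)].

End FreeGroup.

Section GroupQuotient.
Variables (G : groupType) (R : G -> G -> Prop).

(* The smallest congruence on G containing R; the class of 1 is the normal
   closure of the elements x * y^-1 with R x y. *)
Inductive group_cong : G -> G -> Prop :=
| group_cong_rel x y : R x y -> group_cong x y
| group_cong_refl x : group_cong x x
| group_cong_sym x y : group_cong x y -> group_cong y x
| group_cong_trans x y z : group_cong x y -> group_cong y z -> group_cong x z
| group_cong_mul x1 x2 y1 y2 :
    group_cong x1 x2 -> group_cong y1 y2 -> group_cong (x1 * y1) (x2 * y2).

Definition group_congb : rel G := fun x y => `[< group_cong x y >].

Lemma group_congb_refl : reflexive group_congb.
Proof. by move=> x; apply/asboolP/group_cong_refl. Qed.

Lemma group_congb_sym : symmetric group_congb.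
Proof. by move=> x y; apply/asboolP/asboolP; apply: group_cong_sym. Qed.

Lemma group_congb_trans : transitive group_congb.
Proof.
move=> y x z /asboolP xy /asboolP yz; apply/asboolP.
exact: group_cong_trans xy yz.
Qed.

Canonical group_equiv :=
  EquivRel group_congb group_congb_refl group_congb_sym group_congb_trans.

Definition group_quot := {eq_quot group_equiv}.
HB.instance Definition _ := Choice.on group_quot.

Definition group_proj (x : G) : group_quot := \pi_group_quot x.

Lemma group_projP x y : group_proj x = group_proj y <-> group_cong x y.
Proof. by split=> [/eqmodP/asboolP|xy]; [|apply/eqmodP/asboolP]. Qed.

Lemma group_cong_inv x y : group_cong x y -> group_cong x^-1 y^-1.
Proof.
move=> xy; rewrite -[x^-1]mulg1 -(mulgV y) mulgA -[y^-1 in X in group_cong _ X]mul1g.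
apply: group_cong_mul; last exact: group_cong_refl.
rewrite -(mulVg x); apply: group_cong_mul; first exact: group_cong_refl.
exact: group_cong_sym.
Qed.

Definition quot_one : group_quot := group_proj 1.
Definition quot_mul (a b : group_quot) : group_quot :=
  group_proj (repr a * repr b).
Definition quot_inv (a : group_quot) : group_quot :=
  group_proj (repr a)^-1.

Lemma quot_repr x : group_cong (repr (group_proj x)) x.
Proof. by apply/group_projP; rewrite /group_proj reprK. Qed.

Lemma quot_mul_proj x y :
  quot_mul (group_proj x) (group_proj y) = group_proj (x * y).
Proof. by apply/group_projP; apply: group_cong_mul; apply: quot_repr. Qed.

Lemma quot_inv_proj x : quot_inv (group_proj x) = group_proj x^-1.
Proof. by apply/group_projP; apply/group_cong_inv/quot_repr. Qed.

Lemma quot_projW (P : group_quot -> Prop) :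
  (forall x, P (group_proj x)) -> forall a, P a.
Proof. by move=> HP a; rewrite -[a]reprK. Qed.

Lemma quot_mulA : associative quot_mul.
Proof.
move=> a b c; elim/quot_projW: a => x; elim/quot_projW: b => y.
by elim/quot_projW: c => z; rewrite !quot_mul_proj mulgA.
Qed.

Lemma quot_mul1 : left_id quot_one quot_mul.
Proof. by move=> a; elim/quot_projW: a => x; rewrite quot_mul_proj mul1g. Qed.

Lemma quot_mulr1 : right_id quot_one quot_mul.
Proof. by move=> a; elim/quot_projW: a => x; rewrite quot_mul_proj mulg1. Qed.

Lemma quot_mulV : left_inverse quot_one quot_inv quot_mul.
Proof.
move=> a; elim/quot_projW: a => x.
by rewrite quot_inv_proj quot_mul_proj mulVg.
Qed.

Lemma quot_mulrV : right_inverse quot_one quot_inv quot_mul.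
Proof.
move=> a; elim/quot_projW: a => x.
by rewrite quot_inv_proj quot_mul_proj mulgV.
Qed.

HB.instance Definition _ := isGroup.Build group_quot
  quot_mulA quot_mul1 quot_mulr1 quot_mulV quot_mulrV.

Lemma group_projM : {morph group_proj : x y / x * y}.
Proof. by move=> x y; rewrite [RHS]quot_mul_proj. Qed.

HB.instance Definition _ := isUMagmaMorphism.Build G group_quot
  group_proj (erefl, group_projM).

End GroupQuotient.

Section Kernel.
Variables (G H : groupType) (phi : group_hom G H).

Definition ker_pred : pred G := [pred x | phi x == 1].

Lemma ker_closed : group_closed ker_pred.
Proof.
split=> [|x y]; rewrite !inE ?gmulf1 // => /eqP x1 /eqP y1.
by rewrite gmulfF x1 y1 invg1 mulg1.
Qed.

Definition Ker := {x : G | ker_pred x}.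
HB.instance Definition _ := SubChoice.on Ker.
HB.instance Definition _ := SubChoice_isSubGroup.Build G ker_pred Ker ker_closed.

Definition Ker_incl : group_hom Ker G := val : Ker -> G.

End Kernel.

Definition surjective (A B : Type) (f : A -> B) := forall b, exists a, f a = b.

(* 1 -> K -> G -> H -> 1 is exact *)
Definition short_exact (K G H : groupType)
    (i : group_hom K G) (p : group_hom G H) : Prop :=
  [/\ injective i, forall x, p x = 1 <-> exists k, i k = x & surjective p].

Definition splits (G H : groupType) (p : group_hom G H) : Prop :=
  exists s : group_hom H G, cancel s p.

Definition semidirect_decomposition (G H : groupType)
    (p : group_hom G H) : Prop :=
  short_exact (Ker_incl p) p /\ splits p.

(* Indices are shifted by one: i : 'I_n.-1 stands for the index i + 1, so that
   'I_n.-1 represents {1, ..., n-1} and 'I_n represents {1, ..., n}. *)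
Section VirtualSingularBraids.
Variable n : nat.

Definition generator : choiceType := ('I_n.-1 + 'I_n.-1 + 'I_n.-1)%type.

Definition free_sigma (i : 'I_n.-1) := free_gen (inl (inl i) : generator).
Definition free_tau (i : 'I_n.-1) := free_gen (inl (inr i) : generator).
Definition free_v (i : 'I_n.-1) := free_gen (inr i : generator).

Local Notation s := free_sigma.
Local Notation t := free_tau.
Local Notation v := free_v.

Definition far (i j : 'I_n.-1) : bool := (i.+2 <= j) || (j.+2 <= i).

Inductive VSG_rel : free_group generator -> free_group generator -> Prop :=
| far_ss i j : far i j -> VSG_rel (s i * s j) (s j * s i)
| far_vv i j : far i j -> VSG_rel (v i * v j) (v j * v i)
| far_tt i j : far i j -> VSG_rel (t i * t j) (t j * t i)
| far_st i j : far i j -> VSG_rel (s i * t j) (t j * s i)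
| far_sv i j : far i j -> VSG_rel (s i * v j) (v j * s i)
| far_tv i j : far i j -> VSG_rel (t i * v j) (v j * t i)
| inv_v i : VSG_rel (v i ^+ 2) 1
| comm_st i : VSG_rel (s i * t i) (t i * s i)
| braid_sss (i j : 'I_n.-1) : j = i.+1 :> nat ->
    VSG_rel (s i * s j * s i) (s j * s i * s j)
| braid_vvv (i j : 'I_n.-1) : j = i.+1 :> nat ->
    VSG_rel (v i * v j * v i) (v j * v i * v j)
| braid_sst (i j : 'I_n.-1) : j = i.+1 :> nat ->
    VSG_rel (s i * s j * t i) (t j * s i * s j)
| braid_sst' (i j : 'I_n.-1) : j = i.+1 :> nat ->
    VSG_rel (s j * s i * t j) (t i * s j * s i)
| braid_vsv (i j : 'I_n.-1) : j = i.+1 :> nat ->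
    VSG_rel (v i * s j * v i) (v j * s i * v j)
| braid_vtv (i j : 'I_n.-1) : j = i.+1 :> nat ->
    VSG_rel (v i * t j * v i) (v j * t i * v j).

Definition VSG : groupType := group_quot VSG_rel.

Definition VSG_sigma (i : 'I_n.-1) : VSG := group_proj VSG_rel (s i).
Definition VSG_tau (i : 'I_n.-1) : VSG := group_proj VSG_rel (t i).
Definition VSG_v (i : 'I_n.-1) : VSG := group_proj VSG_rel (v i).

Inductive WSG_rel : VSG -> VSG -> Prop :=
| WSG_forbidden (i j : 'I_n.-1) : j = i.+1 :> nat ->
    WSG_rel (VSG_sigma i * VSG_sigma j * VSG_v i)
            (VSG_v j * VSG_sigma i * VSG_sigma j).

Inductive UVSG_rel : VSG -> VSG -> Prop :=
| UVSG_forbidden1 (i j : 'I_n.-1) : j = i.+1 :> nat ->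
    UVSG_rel (VSG_sigma i * VSG_sigma j * VSG_v i)
             (VSG_v j * VSG_sigma i * VSG_sigma j)
| UVSG_forbidden2 (i j : 'I_n.-1) : j = i.+1 :> nat ->
    UVSG_rel (VSG_v i * VSG_sigma j * VSG_sigma i)
             (VSG_sigma j * VSG_sigma i * VSG_v j).

Definition adj_fst (i : 'I_n.-1) : 'I_n := widen_ord (leq_pred n) i.

Lemma adj_snd_subproof (i : 'I_n.-1) : i.+1 < n.
Proof. by case: n i => [|m] i; [case: i|rewrite ltnS; exact: ltn_ord i]. Qed.

Definition adj_snd (i : 'I_n.-1) : 'I_n := Ordinal (adj_snd_subproof i).

Definition adj_tperm (i : 'I_n.-1) : 'S_n := tperm (adj_fst i) (adj_snd i).

End VirtualSingularBraids.

Variant singular_family := Welded | Unrestricted.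

Definition XSG_rel (X : singular_family) (n : nat) : VSG n -> VSG n -> Prop :=
  match X with Welded => @WSG_rel n | Unrestricted => @UVSG_rel n end.

Definition XSG (X : singular_family) (n : nat) : groupType :=
  group_quot (@XSG_rel X n).

Notation WSG := (XSG Welded).
Notation UVSG := (XSG Unrestricted).

Section XSGGenerators.
Variables (X : singular_family) (n : nat).

Definition sigma (i : 'I_n.-1) : XSG X n :=
  group_proj (@XSG_rel X n) (VSG_sigma i).
Definition tau (i : 'I_n.-1) : XSG X n :=
  group_proj (@XSG_rel X n) (VSG_tau i).
Definition virt (i : 'I_n.-1) : XSG X n :=
  group_proj (@XSG_rel X n) (VSG_v i).

End XSGGenerators.

Definition canonical_on_generators (X : singular_family) (n : nat)
    (phi : group_hom (XSG X n) 'S_n) : Prop :=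
  forall i : 'I_n.-1,
    [/\ phi (sigma X i) = adj_tperm i, phi (tau X i) = adj_tperm i
      & phi (virt X i) = adj_tperm i].

(* Main.v *)
(* The symmetric group satisfies the relations of X_n, which gives phi. For the
   section, the elements v_i of X_n satisfy the Coxeter relations of S_n, so it
   suffices that a word in the v_i with trivial image in S_n is trivial in X_n:
   then p |-> (any word in the v_i with image p) is a well-defined morphism.
   Modulo the Coxeter relations a word in v_0, ..., v_m equals w' v_m ... v_k
   with w' a word in v_0, ..., v_(m-1); its image sends m+1 to k, so a trivial
   image forces the descending tail to be empty, and one concludes by induction
   on m. *)
Require Import Defs.
From HB Require Import structures.
From mathcomp Require Import all_boot all_fingroup.
From mathcomp Require Import boolp zify.

Set Implicit Arguments.
Unset Strict Implicit.
Unset Printing Implicit Defensive.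

Local Open Scope group_scope.

(** * Morphisms out of free groups and out of quotients by a congruence *)

Section GroupHomOf.
Variables (G H : groupType) (f : G -> H) (fM : {morph f : x y / x * y}).

Let group_hom_of1 : f 1 = 1.
Proof. by apply: (mulgI (f 1)); rewrite -fM !mulg1. Qed.

Definition group_hom_of : group_hom G H :=
  HB.pack f (isUMagmaMorphism.Build G H f (group_hom_of1, fM)).

End GroupHomOf.

Section FreeLift.
Variables (X : choiceType) (H : groupType) (f : X -> H).

Definition letter_eval (a : X * bool) : H := if a.2 then (f a.1)^-1 else f a.1.
Definition word_eval (w : word X) : H := \prod_(a <- w) letter_eval a.

Lemma word_eval_free_eq u v : free_eq u v -> word_eval u = word_eval v.
Proof.
elim=> {u v} [||w1 w2 w3 _ -> _|w1 w2 x b] //.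
rewrite /word_eval !big_cat /= !big_cons /letter_eval /=; congr (_ * _).
by case: b => /=; rewrite ?mulKg ?mulVKg.
Qed.

Definition free_eval (a : free_group X) : H :=
  word_eval (generic_quotient.repr a).

Lemma free_eval_pi u : free_eval (\pi_(free_group X)%qT u) = word_eval u.
Proof. exact/word_eval_free_eq/free_repr. Qed.

Lemma free_evalM : {morph free_eval : a b / a * b}.
Proof.
move=> a b; elim/free_piW: a => u; elim/free_piW: b => w.
by rewrite [X in free_eval X]free_mul_pi !free_eval_pi /word_eval big_cat.
Qed.

Definition free_lift : group_hom (free_group X) H := group_hom_of free_evalM.

Lemma free_lift_gen x : free_lift (free_gen x) = f x.
Proof. by rewrite [LHS]free_eval_pi /word_eval big_seq1. Qed.

End FreeLift.

Lemma free_hom_ext (X : choiceType) (H : groupType)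
    (f g : group_hom (free_group X) H) :
  (forall x, f (free_gen x) = g (free_gen x)) -> f =1 g.
Proof.
move=> fg a; elim/free_piW: a; elim=> [|[x b] w IH].
  by rewrite [LHS](@gmulf1 _ _ f) [RHS](@gmulf1 _ _ g).
rewrite -cat1s -[\pi_(_)%qT _]free_mul_pi [LHS]gmulfM [RHS]gmulfM IH.
congr (_ * _); case: b; last exact: fg.
have -> : (\pi_(free_group X) [:: (x, true)])%qT = (free_gen x)^-1.
  by rewrite [RHS]free_inv_pi.
by rewrite !gmulfV fg.
Qed.

Section QuotientLift.
Variables (G H : groupType) (R : G -> G -> Prop) (f : group_hom G H).
Hypothesis fR : forall x y, R x y -> f x = f y.

Lemma group_cong_eval x y : group_cong R x y -> f x = f y.
Proof.
elim=> {x y} [||||x1 x2 y1 y2 _ Hx _ Hy] //; first by move=> x y z _ -> _.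
by rewrite !gmulfM Hx Hy.
Qed.

Definition quot_eval (a : group_quot R) : H := f (generic_quotient.repr a).

Lemma quot_eval_proj x : quot_eval (group_proj R x) = f x.
Proof. exact/group_cong_eval/quot_repr. Qed.

Lemma quot_evalM : {morph quot_eval : a b / a * b}.
Proof.
move=> a b; elim/quot_projW: a => x; elim/quot_projW: b => y.
by rewrite -group_projM !quot_eval_proj gmulfM.
Qed.

Definition quot_lift : group_hom (group_quot R) H := group_hom_of quot_evalM.

Lemma quot_lift_proj x : quot_lift (group_proj R x) = f x.
Proof. exact: quot_eval_proj. Qed.

End QuotientLift.

(** * Splitting a morphism to a symmetric group by means of the Coxeter relations *)

Lemma commute_prod_seq (G : groupType) (I : eqType) (r : seq I) (F : I -> G) x :
  {in r, forall i, commute x (F i)} -> commute x (\prod_(i <- r) F i).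
Proof.
elim: r => [|i r IH] H; first by rewrite big_nil; apply: commute1.
rewrite big_cons; apply: commuteM; first by apply: H; rewrite mem_head.
by apply: IH => j jr; apply: H; rewrite inE jr orbT.
Qed.

Section CoxeterSplitting.
Variables (N : nat) (G : groupType) (phi : group_hom G 'S_N.+1) (v : nat -> G).
Hypothesis phiv :
  forall i, i < N -> phi (v i) = tperm (inord i) (inord i.+1).
Hypothesis vv : forall i, i < N -> v i * v i = 1.
Hypothesis vC : forall i j, i.+1 < j -> j < N -> commute (v i) (v j).
Hypothesis vB :
  forall i, i.+1 < N -> v i * v i.+1 * v i = v i.+1 * v i * v i.+1.

Local Notation vprod w := (\prod_(i <- w) v i).
Local Notation below m := (all (ltn^~ m)).

(* The word m, m-1, ..., k, empty for k = m+1. *)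
Definition descent m k := rev (iota k (m.+1 - k)).

Lemma descentS m k : k <= m -> descent m k = rcons (descent m k.+1) k.
Proof. by move=> km; rewrite /descent subSn // subSS /= rev_cons. Qed.

Lemma mem_descent m k i : i \in descent m k = (k <= i <= m).
Proof. by rewrite mem_rev mem_iota; lia. Qed.

Lemma vprod_descentS m k : k <= m ->
  vprod (descent m k) = vprod (descent m k.+1) * v k.
Proof. by move=> km; rewrite descentS // big_rcons. Qed.

Lemma v_descent_commute m k i : m < N -> i.+1 < k ->
  commute (v i) (vprod (descent m k)).
Proof.
move=> mN ik; apply: commute_prod_seq => j; rewrite mem_descent => kj.
by apply: vC; lia.
Qed.

(** Induction on [i - k]. For [i = k] the tail ends in [v k.+1 * v k], the braid relation applies,
    and the resulting left [v k] commutes with all larger letters of the tail. For [i > k] the last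
    letter [v k] commutes with [v i.+1] and is set aside. *)
Lemma vprod_descent_shift m k i : m < N -> k <= i -> i < m ->
  vprod (descent m k) * v i.+1 = v i * vprod (descent m k).
Proof.
move=> mN /subnK => <-; move: (i - k)%N => d; elim: d k => [|d IH] k dm.
  rewrite add0n in dm *; have km : k <= m by lia.
  rewrite (vprod_descentS km) (vprod_descentS dm).
  rewrite -!mulgA (mulgA (v k.+1)) -vB; last by lia.
  by rewrite !mulgA -(v_descent_commute mN).
have km : k <= m by lia.
have kC : commute (v k) (v (d.+1 + k).+1) by apply: vC; lia.
rewrite (vprod_descentS km) -mulgA kC !mulgA.
by rewrite addSnnS IH //; lia.
Qed.

Lemma vprod_coset m w : m < N -> below m.+1 w ->
  exists w' k, [/\ below m w', k <= m.+1
    & vprod w = vprod w' * vprod (descent m k)].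
Proof.
move=> mN; elim/last_ind: w => [|w i IH].
  exists [::], m.+1; split=> //.
  by rewrite /descent subnn !big_nil mulg1.
rewrite all_rcons => /andP[/= im /IH[w' [k [w'm km Ew]]]].
rewrite big_rcons {IH}Ew /=.
(* The appended [v i] is absorbed in one of four ways: for [i.+1 < k] it commutes past the tail into
   the prefix; for [i.+1 = k] it lengthens the tail; for [i > k] it crosses the tail and becomes
   [v i.-1]; for [i = k] it cancels the last letter. *)
case: (ltngtP i k) => ik.
- have [iSk|iSk] := ltnP i.+1 k.
    exists (rcons w' i), k; split=> //.
      by rewrite all_rcons w'm andbT; lia.
    by rewrite big_rcons -mulgA -[_ * v i](v_descent_commute mN iSk) mulgA.
  exists w', i; split=> //; first by lia.
  rewrite [in RHS]vprod_descentS ?mulgA //.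
  by congr (_ * vprod (descent _ _) * _); lia.
- case: i ik im => // i ik im.
  exists (rcons w' i), k; split=> //.
    by rewrite all_rcons w'm andbT; lia.
  by rewrite big_rcons -!mulgA -vprod_descent_shift //; lia.
- subst k; exists w', i.+1; split=> //.
  by rewrite vprod_descentS // -!mulgA vv ?mulg1 //; lia.
Qed.

Lemma phi_below_fix m w x : m <= N -> below m w -> m < x -> x <= N ->
  phi (vprod w) (inord x) = inord x.
Proof.
move=> mN wm mx xN; elim: w wm => [|i w IH] /=.
  by rewrite big_nil gmulf1 perm1.
case/andP=> im wm; rewrite big_cons gmulfM permM phiv; last by lia.
by rewrite tpermD ?IH // -val_eqE /= !inordK; lia.
Qed.

(** Permutations compose from left to right, so the letters [m], ..., [k] move the point [m.+1] down
    one place each. *)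
Lemma phi_descent m k : m < N -> k <= m.+1 ->
  phi (vprod (descent m k)) (inord m.+1) = inord k.
Proof.
move=> mN km; have [d] := ubnP (m.+1 - k); elim: d => // d IH in k km *.
move=> kd; have [kEm|k_neq] := eqVneq k m.+1.
  by rewrite kEm /descent subnn big_nil gmulf1 perm1.
rewrite vprod_descentS; last by lia.
by rewrite gmulfM permM IH ?phiv ?tpermR //; lia.
Qed.

(** The faithfulness half of the Coxeter presentation of the symmetric group. *)
Lemma vprod_eq1 m w : m <= N -> below m w -> phi (vprod w) = 1 -> vprod w = 1.
Proof.
elim: m w => [|m IH] w mN; first by case: w => // _ _; rewrite big_nil.
move=> /(vprod_coset mN)[w' [k [w'm km ->]]] phi1.
have kE : k = m.+1.
  have := congr1 (fun p : 'S_N.+1 => p (inord m.+1)) phi1.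
  rewrite /= gmulfM permM (@phi_below_fix m) //; last by lia.
  rewrite phi_descent // perm1 => /(congr1 val) /=.
  by rewrite !inordK //; lia.
move: phi1; rewrite kE /descent subnn big_nil mulg1.
by apply: IH => //; lia.
Qed.

(** Each [v i] is an involution, so words without inverse letters are already closed under
    inversion. *)
Lemma vprod_rev w : below N w -> vprod w * vprod (rev w) = 1.
Proof.
elim: w => [|i w IH] /=; first by rewrite !big_nil mulg1.
case/andP=> iN wN; rewrite rev_cons big_rcons big_cons /=.
by rewrite -mulgA (mulgA (vprod w)) IH // mul1g vv.
Qed.

Lemma vprod_inj w1 w2 : below N w1 -> below N w2 ->
  phi (vprod w1) = phi (vprod w2) -> vprod w1 = vprod w2.
Proof.
move=> w1N w2N E; have w2rE := vprod_rev w2N.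
apply: (mulIg (vprod (rev w2))); rewrite w2rE -big_cat.
apply: (vprod_eq1 (leqnn N)); first by rewrite all_cat all_rev w1N.
by rewrite big_cat gmulfM E -gmulfM w2rE gmulf1.
Qed.

(** Taken as a finite set, so that results on generators of finite groups apply to it. *)
Definition v_image : {set 'S_N.+1} :=
  [set p | `[< exists2 w, below N w & phi (vprod w) = p >]].

Lemma v_imageP p :
  reflect (exists2 w, below N w & phi (vprod w) = p) (p \in v_image).
Proof. by rewrite inE; apply: asboolP. Qed.

Lemma v_image_group_set : group_set v_image.
Proof.
apply/group_setP; split.
  by apply/v_imageP; exists [::]; rewrite // big_nil gmulf1.
move=> p q /v_imageP[w wN <-] /v_imageP[u uN <-]; apply/v_imageP.
by exists (w ++ u); rewrite ?all_cat ?wN // big_cat gmulfM.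
Qed.

Canonical v_image_group := Group v_image_group_set.

Lemma v_image_adjacent i :
  i < N -> tperm (inord i) (inord i.+1) \in v_image.
Proof.
by move=> iN; apply/v_imageP; exists [:: i]; rewrite /= ?iN // big_seq1 phiv.
Qed.

Lemma v_imageT : v_image = [set: 'S_N.+1].
Proof.
apply/eqP; rewrite eqEsubset subsetT -(gen_tperm ord0) gen_subG.
apply/subsetP => _ /imsetP[y _ ->]; rewrite -(inord_val y).
elim: (val y) (ltn_ord y) => [|j IH] jN.
  rewrite (_ : inord 0 = ord0) ?tperm1 ?group1 //.
  by apply/val_inj; rewrite /= inordK.
have {}IH := IH (ltnW jN); case: j => [|j] in IH jN *.
  rewrite (_ : ord0 = inord 0) ?v_image_adjacent //.
  by apply/val_inj; rewrite /= inordK.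
have -> : tperm ord0 (inord j.+2) =
          tperm ord0 (inord j.+1) ^ tperm (inord j.+1) (inord j.+2) :> 'S_N.+1.
  by rewrite tpermJ tpermL tpermD // -val_eqE /= inordK //; lia.
by rewrite groupJ ?v_image_adjacent.
Qed.

Lemma v_word_exists p : exists2 w, below N w & phi (vprod w) = p.
Proof. by apply/v_imageP; rewrite v_imageT inE. Qed.

Definition v_word p : seq nat := s2val (cid2 (v_word_exists p)).

Lemma below_v_word p : below N (v_word p).
Proof. exact: (s2valP (cid2 (v_word_exists p))). Qed.

Lemma phi_v_word p : phi (vprod (v_word p)) = p.
Proof. exact: (s2valP' (cid2 (v_word_exists p))). Qed.

(** The chosen word for [p * q] need not be the concatenation of those for [p] and [q], but both
    have the same image, so [vprod_inj] identifies their products. *)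
Lemma v_wordM : {morph (fun p => vprod (v_word p)) : p q / p * q}.
Proof.
move=> p q; rewrite /= -big_cat; apply: vprod_inj.
- exact: below_v_word.
- by rewrite all_cat !below_v_word.
- by rewrite big_cat gmulfM !phi_v_word.
Qed.

Lemma coxeter_splits : splits phi.
Proof. by exists (group_hom_of v_wordM) => p; apply: phi_v_word. Qed.

End CoxeterSplitting.

(** * The canonical morphism, its uniqueness, and the relations among the [virt X i] *)

Section Symmetric.
Variable n : nat.
Implicit Types i j : 'I_n.-1.

Lemma adj_tperm_inv i : adj_tperm i * adj_tperm i = 1.
Proof. exact: tperm2. Qed.

Lemma adj_tperm_far i j : far i j ->
  adj_tperm i * adj_tperm j = adj_tperm j * adj_tperm i.
Proof.
rewrite /far => ij; apply/commute_sym/commgP/conjg_fixP.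
by rewrite tpermJ !tpermD // -val_eqE /=; lia.
Qed.

Lemma adj_tperm_braid i j : j = i.+1 :> nat ->
  adj_tperm i * adj_tperm j * adj_tperm i =
  adj_tperm j * adj_tperm i * adj_tperm j.
Proof.
move=> ij; have E : adj_snd i = adj_fst j by apply/val_inj.
have sym k : (adj_tperm k)^-1 = adj_tperm k by apply: tpermV.
transitivity (adj_tperm j ^ adj_tperm i); first by rewrite /conjg sym mulgA.
transitivity (adj_tperm i ^ adj_tperm j); last by rewrite /conjg sym mulgA.
(* Both conjugates are the transposition of the two outer points. *)
rewrite !tpermJ /adj_tperm E tpermL tpermR tpermD ?tpermD // -val_eqE /=; lia.
Qed.

Definition letter_tperm (x : generator n) : 'S_n :=
  match x with inl (inl i) | inl (inr i) | inr i => adj_tperm i end.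

(** Once the three families of generators are identified, every relation becomes a Coxeter relation
    or a trivial identity. *)
Lemma VSG_rel_tperm x y : VSG_rel x y ->
  free_lift letter_tperm x = free_lift letter_tperm y.
Proof.
case=> [i j ij|i j ij|i j ij|i j ij|i j ij|i j ij|i|i|i j ij|i j ij|i j ij
       |i j ij|i j ij|i j ij];
  rewrite ?gmulfXn ?gmulf1 ?gmulfM !free_lift_gen //=;
  by [ apply: adj_tperm_far | apply: adj_tperm_inv
     | apply: adj_tperm_braid | symmetry; apply: adj_tperm_braid ].
Qed.

Definition VSG_to_Sym : group_hom (VSG n) 'S_n := quot_lift VSG_rel_tperm.

Lemma VSG_to_Sym_gen i :
  [/\ VSG_to_Sym (VSG_sigma i) = adj_tperm i,
      VSG_to_Sym (VSG_tau i) = adj_tperm i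
    & VSG_to_Sym (VSG_v i) = adj_tperm i].
Proof. by split; rewrite [LHS]quot_lift_proj free_lift_gen. Qed.

Lemma XSG_rel_tperm X x y : @XSG_rel X n x y -> VSG_to_Sym x = VSG_to_Sym y.
Proof.
have E i := VSG_to_Sym_gen i.
by case: X => -[] i j ij; rewrite !gmulfM;
  have [-> _ ->] := E i; have [-> _ ->] := E j; apply: adj_tperm_braid.
Qed.

Definition XSG_to_Sym X : group_hom (XSG X n) 'S_n :=
  quot_lift (@XSG_rel_tperm X).

Lemma XSG_to_Sym_canonical X : canonical_on_generators (XSG_to_Sym X).
Proof.
move=> i; have [Hs Ht Hv] := VSG_to_Sym_gen i.
by split; rewrite [LHS]quot_lift_proj.
Qed.

Lemma VSG_rel_XSG X x y : VSG_rel x y ->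
  group_proj (@XSG_rel X n) (group_proj (@VSG_rel n) x) =
  group_proj (@XSG_rel X n) (group_proj (@VSG_rel n) y).
Proof. by move=> xy; congr group_proj; apply/group_projP/group_cong_rel. Qed.

Lemma virt_inv X i : virt X i * virt X i = 1.
Proof.
by have /(VSG_rel_XSG X) := inv_v i; rewrite expg2 !group_projM !gmulf1.
Qed.

Lemma virt_far X i j : far i j -> commute (virt X i) (virt X j).
Proof. by move=> /far_vv/(VSG_rel_XSG X); rewrite !group_projM. Qed.

Lemma virt_braid X i j : j = i.+1 :> nat ->
  virt X i * virt X j * virt X i = virt X j * virt X i * virt X j.
Proof. by move=> /braid_vvv/(VSG_rel_XSG X); rewrite !group_projM. Qed.

Lemma XSG_hom_ext X (H : groupType) (f g : group_hom (XSG X n) H) :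
  (forall i, [/\ f (sigma X i) = g (sigma X i), f (tau X i) = g (tau X i)
    & f (virt X i) = g (virt X i)]) -> f =1 g.
Proof.
move=> fg a; elim/quot_projW: a => b; elim/quot_projW: b => c.
(* Composing with both projections reduces the claim to morphisms out of the free group. *)
pose p x := group_proj (@XSG_rel X n) (group_proj (@VSG_rel n) x).
have pM : {morph p : x y / x * y} by move=> x y; rewrite /p !group_projM.
have ext := @free_hom_ext _ H
  (f \o group_hom_of pM) (g \o group_hom_of pM).
apply: ext => -[[i|i]|i]; by have [] := fg i.
Qed.

End Symmetric.

Theorem proposition40 (n : nat) (n_ge2 : 2 <= n) (X : singular_family) :
  exists phi : group_hom (XSG X n) 'S_n,
    [/\ canonical_on_generators phi,
        forall psi : group_hom (XSG X n) 'S_n,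
          canonical_on_generators psi -> psi =1 phi,
        surjective phi
      & semidirect_decomposition phi].
Proof.
have can := @XSG_to_Sym_canonical n X; exists (XSG_to_Sym n X).
have spl : splits (XSG_to_Sym n X).
  case: n n_ge2 can => [|[|N]] // _ can.
  (* With [n = N.+2] the generators have indices 0 to [N]; [inord] extends the family to all
     naturals, and its default value is irrelevant since only [i <= N] is used. *)
  pose v i := @virt X N.+2 (inord i : 'I_N.+1).
  have adjE i : i <= N -> @adj_tperm N.+2 (inord i : 'I_N.+1) =
      tperm (inord i) (inord i.+1) :> 'S_N.+2.
    by move=> iN; congr tperm; apply/val_inj; rewrite /= !inordK //; lia.
  apply: (@coxeter_splits N.+1 _ _ v).
  - by move=> i iN; have [_ _ ->] := can (inord i : 'I_N.+1); apply: adjE.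
  - by move=> i iN; apply: virt_inv.
  - by move=> i j ij jN; apply: virt_far; rewrite /far !inordK; lia.
  - by move=> i iN; apply: virt_braid; rewrite !inordK; lia.
(* The section itself supplies the preimages. *)
have surj : surjective (XSG_to_Sym n X) by case: spl => s sK p; exists (s p).
split=> // [psi psi_can|].
  apply: XSG_hom_ext => i.
  by have [-> -> ->] := psi_can i; have [-> -> ->] := can i.
split=> //; split=> // [|x]; first exact: val_inj.
split=> [x1|[k <-]]; last by apply/eqP/(valP k).
have xK : ker_pred (XSG_to_Sym n X) x by apply/eqP.
by exists (exist _ x xK).
Qed.
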